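(* Suppose that $\lambda$ is a regular cardinal, $\kappa<\lambda$ is regular, and for each cardinal $\sigma\in(\kappa,\lambda)$ there is a $\mathcal P_\sigma\subseteq[\sigma]^{<\kappa}$ such that $|\mathcal P_\sigma|<\lambda$ and $$a\in[\sigma]^\kappa\implies(\exists b\in[a]^\kappa)\ \bigl([b]^{<\kappa}\subseteq\mathcal P_\sigma\bigr).$$ Then there is an $S\in I[\lambda]$ such that $$A(S)=\bigl\{\delta\in\lambda:\ \mathrm{cf}(\delta)=\theta\text{ for some regular }\theta\in(\kappa,\lambda)\text{ such that }2^{<\kappa}<\theta,\ S^\theta_\kappa\in I[\theta],\text{ and }S^\delta_\kappa\setminus S\text{ is stationary in }\delta\bigr\}$$ is nonstationary in $\lambda$.
   Context: For an ordinal $\gamma$, $S^\gamma_\kappa=\{\delta<\gamma:\mathrm{cf}(\delta)=\kappa\}$, where $\kappa$ is an infinite regular cardinal. $[a]^\kappa$ and $[a]^{<\kappa}$ are the families of subsets of $a$ of size $\kappa$, respectively $<\kappa$. For a set of ordinals $C$, $\mathrm{acc}(C)=\{\alpha\in C:\alpha=\sup(C\cap\alpha)\}$ and $\mathrm{nacc}(C)=C\setminus\mathrm{acc}(C)$. For a regular uncountable cardinal $\lambda$, $I[\lambda]$ is the family of all $S\subseteq\lambda$ for which there are $S^+\subseteq\lambda$ with $S\setminus S^+$ nonstationary and a sequence $\langle C_\delta:\delta<\lambda\rangle$ such that: (a) $C_\delta$ is a closed subset of $\delta$; (b) if $\alpha\in\mathrm{nacc}(C_\delta)$ then $C_\alpha=\alpha\cap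 C_\delta$; (c) if $\delta\in S^+$ then $\delta=\sup(C_\delta)$ and $\mathrm{otp}(C_\delta)=\mathrm{cf}(\delta)<\delta$; (d) $\mathrm{nacc}(C_\delta)$ is a set of successor ordinals. *)

(* Defs.v *)
From mathcomp Require Import all_boot all_order.
From mathcomp Require Import boolp classical_sets functions cardinality.

Set Implicit Arguments.
Unset Strict Implicit.
Unset Printing Implicit Defensive.

Local Open Scope classical_set_scope.
Local Open Scope card_scope.

(* Ordinals are the elements of an arbitrary well-ordered type [O], that is, an
   arbitrary ordinal serving as the ambient class of ordinals. An element
   [delta] is identified with the set [below delta] of its predecessors. Every
   notion below depends only on the ordinals up to the ones mentioned in it, so
   the choice of [O] beyond them is irrelevant. *)

Definition card_lt T U (A : set T) (B : set U) : Prop :=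
  A #<= B /\ ~ (B #<= A).

Section Ordinals.
Context {d : Order.disp_t} {O : orderType d}.
Implicit Types (alpha beta gamma delta theta kappa lambda mu rho : O).
Implicit Types (A C S : set O).

Definition well_ordered : Prop := well_founded (fun x y : O => (x < y)%O).

Definition below delta : set O := [set x | (x < delta)%O].

Definition is_least A alpha : Prop := A alpha /\ lbound A alpha.

Definition is_successor alpha : Prop :=
  exists beta, (beta < alpha)%O /\ forall gamma, (gamma < alpha)%O -> (gamma <= beta)%O.

Definition is_cardinal alpha : Prop :=
  forall beta, (beta < alpha)%O -> ~ (below alpha #<= below beta).

(* The relation otp(A) = alpha. *)
Definition order_type A alpha : Prop :=
  exists f : O -> O, set_bij (below alpha) A f /\
    forall x y, (x < alpha)%O -> (y < alpha)%O -> (x < y)%O -> (f x < f y)%O.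

Definition cofinal_in delta A : Prop :=
  A `<=` below delta /\
  forall beta, (beta < delta)%O -> exists2 gamma, A gamma & (beta <= gamma)%O.

(* The relation cf(delta) = theta. *)
Definition cofinality delta theta : Prop :=
  is_least [set eta | exists2 A, cofinal_in delta A & order_type A eta] theta.

Definition is_regular kappa : Prop :=
  [/\ infinite_set (below kappa), is_cardinal kappa & cofinality kappa kappa].

(* S^gamma_kappa *)
Definition cof_set gamma kappa : set O :=
  [set delta | (delta < gamma)%O /\ cofinality delta kappa].

(* [a]^kappa and [a]^{<kappa} *)
Definition subsets_eq (a : set O) kappa : set (set O) :=
  [set b | b `<=` a /\ b #= below kappa].
Definition subsets_lt (a : set O) kappa : set (set O) :=
  [set b | b `<=` a /\ card_lt b (below kappa)].

(* The relation 2^{<kappa} = rho, where 2^{<kappa} = sup_{mu < kappa} 2^mu: the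
   least ordinal rho with |P(mu)| <= |rho| for all cardinals mu < kappa is that
   supremum. Quantifying over upper bounds avoids asking that each 2^mu be an
   element of [O]. *)
Definition is_weak_power kappa rho : Prop :=
  is_least [set eta | forall mu, is_cardinal mu -> (mu < kappa)%O ->
                        [set b : set O | b `<=` below mu] #<= below eta] rho.

(* Here sup of the empty set is 0, so 0 is in acc(C) as soon as it is in C. *)
Definition acc C : set O :=
  [set alpha | C alpha /\ isLub (C `&` below alpha) alpha].
Definition nacc C : set O := C `\` acc C.

(* Nonemptiness makes alpha a genuine limit point; otherwise, as sup of the
   empty set is 0, every closed set would have to contain 0. *)
Definition closed_in delta C : Prop :=
  C `<=` below delta /\
  forall alpha, (alpha < delta)%O -> C `&` below alpha !=set0 ->
    isLub (C `&` below alpha) alpha -> C alpha.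

Definition stationary delta S : Prop :=
  forall C, closed_in delta C -> cofinal_in delta C -> S `&` C !=set0.

(* I[lambda] *)
Definition approachable lambda : set (set O) :=
  [set S | S `<=` below lambda /\
    exists Splus (C : O -> set O),
      [/\ Splus `<=` below lambda, ~ stationary lambda (S `\` Splus) &
      [/\ forall delta, (delta < lambda)%O -> closed_in delta (C delta),
          forall delta alpha, (delta < lambda)%O -> nacc (C delta) alpha ->
            C alpha = below alpha `&` C delta,
          forall delta, Splus delta ->
            isLub (C delta) delta /\
            exists theta, [/\ order_type (C delta) theta, cofinality delta theta
                            & (theta < delta)%O] &
          forall delta, (delta < lambda)%O -> nacc (C delta) `<=` is_successor]]].

End Ordinals.

Arguments well_ordered {d} O.

(* Main.v *)
Require Import Defs.
From mathcomp Require Import all_boot all_order.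
From mathcomp Require Import boolp classical_sets functions cardinality.
Import Order.Theory.

Local Open Scope classical_set_scope.

(** The families carried by the cardinals below lambda are first moved along
    bijections to all ordinals alpha < lambda with |alpha| > kappa
    ([transferred_families]). Fewer than lambda sets sit at each alpha and lambda
    is regular, so one function dec from lambda to sets lists all of them, a set
    of the family at alpha having a code between alpha and some e(alpha) < lambda
    ([enumeration]). Write K(x) for the least code of x lying above all the
    elements of x.

    S consists of the delta of cofinality kappa that have a cofinal subset A of
    order type kappa each of whose proper initial segments is computed, uniformly,
    from its next element. For such a coherent system the sets of successors of
    the elements of A, closed under suprema, form a ladder system as required by
    I[lambda], with S^+ = S ([coherent_points_approachable]).
    To produce such an A it is enough to find a cofinal b in gamma, of order type
    kappa, all of whose proper initial segments are coded below gamma: the codes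
    K(b /\ beta), beta in b, tend to gamma, and those exceeding all the previous
    ones (the records) form a set A of the right type. A record K(b /\ beta)
    decodes to b /\ beta, from which all the previous records can be read off
    ([records_coherent_point]).

    If there is no regular cardinal strictly between kappa and lambda, then A(S) is
    empty. Otherwise fix one, theta0; the ordinals from theta0 on have cardinality
    greater than kappa. The club witnessing that A(S) is nonstationary is the set E
    of points above theta0 closed under e. Let delta in E have cofinality theta,
    where 2^{<kappa} < theta and S^theta_kappa is in I[theta] through a ladder
    system C; let f be increasing and cofinal from theta to delta. For j < theta
    with |C_j| < kappa there are at most 2^{<kappa} < theta = cf(delta) subsets of
    f[C_j], so the codes below delta that they have are bounded below delta, by
    f(h(j)) say. Consider the club of gamma = sup f[i] with i closed under h, where
    h is chosen such that i also lies in a club on which all points of cofinality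
    kappa carry a ladder. If cf(gamma) = kappa, then f[C_i] is a subset of gamma of
    size kappa, so some b of size kappa inside f[C_i] has all its small subsets in
    the family at gamma, and these have codes below delta since delta is closed
    under e. An initial segment of b is moreover contained in f[C_j] for some j in
    nacc(C_i), because C_j is an initial segment of C_i; as h(j) < i, its code is
    below f(h(j)) < gamma. Hence gamma is in S, and S^delta_kappa minus S is not
    stationary in delta ([coherent_points_club]). *)

(** * Cardinal comparison through plain functions *)

Section Cardinality.
Set Implicit Arguments.
Unset Strict Implicit.
Unset Printing Implicit Defensive.
Local Open Scope card_scope.

Lemma card_le_cover T U (f : T -> U) (A : set T) (B : set U) :
  B `<=` f @` A -> B #<= A.
Proof.
by move=> BfA; apply: card_le_trans (subset_card_le BfA) (card_image_le _ _).
Qed.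

Lemma card_le_surj T U (y0 : U) (A : set T) (B : set U) :
  B #<= A -> exists f : T -> U, B `<=` f @` A.
Proof.
move=> /(elimT pfcard_geP) => -[->|[f]]; first by exists (fun=> y0).
exact: (ex_intro _ (f : T -> U) (@surj _ _ _ _ f)).
Qed.

Lemma card_le_injection T U (y0 : U) (A : set T) (B : set U) :
  A #<= B -> exists f : T -> U,
    (forall x, A x -> B (f x)) /\
    forall x y, A x -> A y -> f x = f y -> x = y.
Proof.
have [[x0 _]|A0 _] := pselect (exists x, A x); last first.
  by exists (fun=> y0); split=> [x Ax|x y Ax]; case: A0; exists x.
move=> /(card_le_surj x0)[g AgB].
have /choice[f fP] x : exists y, A x -> B y /\ g y = x.
  have [/AgB[y By <-]|nAx] := pselect (A x); first by exists y.
  by exists y0.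
exists f; split=> [x /fP[]//|x y Ax Ay fxy].
by have [_ <-] := fP _ Ax; have [_ <-] := fP _ Ay; rewrite fxy.
Qed.

Lemma card_le_of_injection T U (f : T -> U) (A : set T) (B : set U) :
  (forall x, A x -> B (f x)) ->
  (forall x y, A x -> A y -> f x = f y -> x = y) -> A #<= B.
Proof.
move=> fAB finj; have fI : {in A &, injective f}.
  by move=> x y; rewrite !inE; exact: finj.
have /card_eqPle[_ le1] := inj_card_eq fI.
by apply: card_le_trans le1 (subset_card_le _) => _ [x /fAB ? <-].
Qed.

End Cardinality.

Section Ordinals.
Set Implicit Arguments.
Unset Strict Implicit.
Unset Printing Implicit Defensive.
Local Open Scope order_scope.
Local Open Scope classical_set_scope.
Local Open Scope card_scope.
Context {d : Order.disp_t} {O : orderType d} (wfO : well_ordered O).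
Implicit Types (alpha beta gamma delta theta kappa lambda mu nu rho eta : O).
Implicit Types (A B X Y S : set O).

(** * Least elements, recursion and increasing maps *)

Lemma nle_lt (x y : O) : ~ (x <= y) -> y < x.
Proof. by move/negP; rewrite -ltNge. Qed.

Lemma nlt_le (x y : O) : ~ (x < y) -> y <= x.
Proof. by move/negP; rewrite -leNgt. Qed.

Lemma least_exists A : A !=set0 -> exists m, is_least A m.
Proof.
case=> x; elim/(well_founded_ind wfO): x => x IH Ax.
have [[y [Ay yx]]|nle] := pselect (exists y, A y /\ y < x); first exact: IH Ay.
exists x; split=> // y Ay; apply: nlt_le => yx.
by apply: nle; exists y.
Qed.

Lemma least_unique A alpha beta :
  is_least A alpha -> is_least A beta -> alpha = beta.
Proof.
by move=> [Aa la] [Ab lb]; apply: le_anti; rewrite (la _ Ab) (lb _ Aa).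
Qed.

(** Transfinite recursion in the only form used below. The value is constrained
    only where the earlier values are bounded; in each use an induction shows that
    this is the case everywhere. *)
Lemma least_recursion T (R : T -> T -> Prop) (wfR : well_founded R)
    (P : T -> set O) (o : O) :
  exists r : T -> O, forall x,
    (exists i, P x i /\ forall y, R y x -> r y < i) ->
    is_least [set i | P x i /\ forall y, R y x -> r y < i] (r x).
Proof.
pose step x (rec : forall y, R y x -> O) :=
  xget o (is_least [set i | P x i /\ forall y (yx : R y x), rec y yx < i]).
exists (Fix wfR _ step) => x ok.
have step_ext y f g : (forall z zy, f z zy = g z zy) -> step y f = step y g.
  move=> fg; suff -> : f = g by [].
  by apply: functional_extensionality_dep => z;
     apply: functional_extensionality_dep => zy; exact: fg.
rewrite (Fix_eq wfR (fun=> O) step step_ext x).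
apply: (xgetPex o (P := is_least _)).
exact: least_exists.
Qed.

Lemma lub_exists X gamma : (forall x, X x -> x <= gamma) ->
  exists2 s, isLub X s & s <= gamma.
Proof.
move=> Xg; have [s [us ls]] : exists s, is_least (ubound X) s.
  by apply: least_exists; exists gamma.
by exists s; [split|exact: ls].
Qed.

Lemma lub_gt X s beta : isLub X s -> beta < s -> exists2 x, X x & beta < x.
Proof.
move=> [_ ls] bs; apply: contrapT => nex.
have /ls : ubound X beta.
  by move=> x Xx; apply: nlt_le => bx; apply: nex; exists x.
by rewrite leNgt bs.
Qed.

Definition increasing_on X (f : O -> O) :=
  forall x y, X x -> X y -> x < y -> f x < f y.

Lemma increasing_le X f x y : increasing_on X f -> X x -> X y ->
  x <= y -> f x <= f y.
Proof.
move=> fX Xx Xy; rewrite le_eqVlt => /orP[/eqP->//|xy].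
by apply: ltW; exact: fX.
Qed.

Lemma increasing_lt_inv X f x y : increasing_on X f -> X x -> X y ->
  f x < f y -> x < y.
Proof.
move=> fX Xx Xy fxy; apply: nle_lt => /(increasing_le fX Xy Xx).
by rewrite leNgt fxy.
Qed.

Lemma increasing_inj X f x y : increasing_on X f -> X x -> X y ->
  f x = f y -> x = y.
Proof.
move=> fX Xx Xy fxy; case: (ltgtP x y) => // /fX.
  by move=> /(_ Xx Xy); rewrite fxy ltxx.
by move=> /(_ Xy Xx); rewrite fxy ltxx.
Qed.

(** If beta < alpha, then f decreases beta, and the least point that f decreases
    is mapped to a smaller one of the same kind. *)
Lemma increasing_ge (f : O -> O) alpha beta :
  increasing_on (below alpha) f -> (forall x, x < alpha -> f x < beta) ->
  alpha <= beta.
Proof.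
move=> fi fb; apply: nlt_le => ba.
have [m [[ma fm] lm]] : exists m, is_least [set x | x < alpha /\ f x < x] m.
  by apply: least_exists; exists beta; split; [|exact: fb].
have fma := lt_trans fm ma.
have /lm : [set x | x < alpha /\ f x < x] (f m) by split=> //; exact: fi.
by rewrite leNgt fm.
Qed.

(** * Order types and cofinality *)

(** The collapse r y = least ordinal above all the r z, z in Y below y, stays
    below g and its range is an initial segment. *)
Lemma order_type_exists Y (g : O -> O) kappa : increasing_on Y g ->
  (forall y, Y y -> g y < kappa) -> exists2 eta, eta <= kappa & order_type Y eta.
Proof.
move=> gi gk.
have wfR : well_founded (fun y x : O => Y y /\ y < x).
  move=> x; elim/(well_founded_ind wfO): x => x IH.
  by constructor=> y [_ yx]; exact: IH.
have [r rP] := least_recursion wfR (fun=> setT) kappa.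
have rg x : Y x -> is_least
    [set i | setT i /\ forall y, Y y /\ y < x -> r y < i] (r x) /\ r x <= g x.
  elim/(well_founded_ind wfO): x => x IH Yx.
  have gok : setT (g x) /\ forall y, Y y /\ y < x -> r y < g x.
    split=> // y [Yy yx]; apply: le_lt_trans (gi _ _ Yy Yx yx).
    by have [] := IH y yx Yy.
  have rx : is_least [set i | setT i /\ forall y, Y y /\ y < x -> r y < i] (r x).
    by apply: rP; exists (g x).
  by split=> //; case: rx => _; apply.
have ri : increasing_on Y r.
  by move=> x y Yx Yy xy; have [[[_ +] _] _] := rg _ Yy; apply.
have rdown i x : Y x -> i < r x -> exists2 y, Y y & r y = i.
  elim/(well_founded_ind wfO): x => x IH Yx ix.
  have [y [Yy yx iy]] : exists y, [/\ Y y, y < x & i <= r y].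
    apply: contrapT => nex; have [[_ lx] _] := rg _ Yx.
    suff /lx : [set i | setT i /\ forall y, Y y /\ y < x -> r y < i] i.
      by rewrite leNgt ix.
    split=> // y [Yy yx]; apply: nle_lt => iy; apply: nex; exists y.
    by split.
  move: iy; rewrite le_eqVlt => /orP[/eqP->|]; first by exists y.
  exact: IH.
have [eta [nr le]] : exists eta, is_least [set i | ~ exists2 y, Y y & r y = i] eta.
  apply: least_exists; exists kappa => -[y Yy ryk].
  have [_] := rg _ Yy; rewrite ryk leNgt => /negP; apply; exact: gk.
exists eta.
  apply: nlt_le => ke; apply: nr; exfalso.
  have /(_ kappa) : forall i, i < eta -> exists2 y, Y y & r y = i.
    move=> i ie; apply: contrapT => /le; by rewrite leNgt ie.
  move=> /(_ ke)[y Yy ryk].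
  have [_] := rg _ Yy; rewrite ryk leNgt => /negP; apply; exact: gk.
have reta y : Y y -> r y < eta.
  move=> Yy; apply: nle_lt; rewrite le_eqVlt => /orP[/eqP e|].
    by apply: nr; exists y.
  by move=> /(rdown _ _ Yy).
pose f i := xget kappa [set y | Y y /\ r y = i].
have fP i : i < eta -> Y (f i) /\ r (f i) = i.
  move=> ie; apply: (xgetPex kappa (P := [set y | Y y /\ r y = i])).
  have [y Yy yi] : exists2 y, Y y & r y = i.
    by apply: contrapT => /le; rewrite leNgt ie.
  by exists y.
exists f; split; first split.
- by move=> i /fP[].
- move=> i j; rewrite !inE => /fP[_ {2}<-] /fP[_ {2}<-] -> //.
- move=> y Yy; have ry := reta _ Yy; exists (r y) => //.
  have [Yf rf] := fP _ ry; exact: increasing_inj ri _ _ _.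
move=> i j /fP[Yi ei] /fP[Yj ej] ij.
by apply: (increasing_lt_inv ri) => //; rewrite ei ej.
Qed.

Lemma order_typeP X eta : order_type X eta -> exists f : O -> O,
  [/\ increasing_on (below eta) f, forall i, i < eta -> X (f i) &
      forall x, X x -> exists2 i, i < eta & f i = x].
Proof.
by move=> [f [[f1 f2 f3] f4]]; exists f; split.
Qed.

Lemma order_type_inv X eta : order_type X eta -> exists g : O -> O,
  [/\ increasing_on X g, forall x, X x -> g x < eta &
      forall i, i < eta -> exists2 x, X x & g x = i].
Proof.
move=> /order_typeP[f [fi fX fsurj]].
have /choice[g gP] x : exists i, X x -> i < eta /\ f i = x.
  by have [/fsurj[i ? ?]|?] := pselect (X x); [exists i|exists x].
exists g; split=> [x y Xx Xy xy|x /gP[]//|i ie].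
  have [? ex] := gP _ Xx; have [? ey] := gP _ Xy.
  by apply: (increasing_lt_inv fi) => //; rewrite ex ey.
exists (f i); first exact: fX.
have [? e] := gP _ (fX _ ie).
exact: (increasing_inj fi).
Qed.

Lemma order_type_embed X Y eta zeta g :
  order_type X eta -> order_type Y zeta -> increasing_on X g ->
  (forall x, X x -> Y (g x)) -> eta <= zeta.
Proof.
move=> /order_typeP[f [fi fX _]] /order_type_inv[h [hi hz _]] gi gXY.
apply: (@increasing_ge (h \o g \o f)) => [x y xe ye xy|x xe] /=.
  apply: hi; [exact/gXY/fX..|].
  by apply: gi; [exact: fX..|exact: fi].
by apply/hz/gXY/fX.
Qed.

Lemma order_type_card X eta : order_type X eta ->
  X #<= below eta /\ below eta #<= X.
Proof.
move=> /[dup] /order_typeP[f [_ _ fs]] /order_type_inv[g [_ _ gs]]; split.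
  by apply: (card_le_cover (f := f)) => x /fs[i ? <-]; exists i.
by apply: (card_le_cover (f := g)) => x /gs[i ? <-]; exists i.
Qed.

Lemma order_type_sub Y delta : Y `<=` below delta ->
  exists2 eta, eta <= delta & order_type Y eta.
Proof. by move=> Yd; apply: (@order_type_exists _ id). Qed.

Lemma order_type_image X eta f : order_type X eta -> increasing_on X f ->
  order_type (f @` X) eta.
Proof.
move=> [g [[g1 g2 g3] g4]] fi; exists (f \o g); split; first split.
- by move=> i /g1 Xi; exists (g i).
- move=> i j ie je /= e; apply: g2 => //; rewrite !inE in ie je.
  by apply: (increasing_inj fi) => //; exact: g1.
- by move=> _ [x /g3[i ie <-] <-]; exists i.
by move=> x y xe ye xy /=; apply: fi; [exact: g1..|exact: g4].
Qed.

(** The increasing map g back into X makes an order type of Y exist and not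
    exceed that of X. *)
Lemma order_type_squeeze X Y eta g : order_type X eta -> X `<=` Y ->
  increasing_on Y g -> (forall y, Y y -> X (g y)) -> order_type Y eta.
Proof.
move=> otX XY gi gYX; have [h [hi he _]] := order_type_inv otX.
have [zeta ze otY] : exists2 zeta, zeta <= eta & order_type Y zeta.
  apply: (@order_type_exists _ (h \o g)) => [x y Yx Yy xy|y Yy] /=.
    by apply: hi; [exact: gYX..|exact: gi].
  exact/he/gYX.
have ez : eta <= zeta by apply: (order_type_embed otX otY (g := id)).
by have <- : zeta = eta by apply: le_anti; rewrite ze ez.
Qed.

(** The form in which cofinality is used: an unbounded Z would have an order type
    at least theta. *)
Lemma small_bounded delta theta Z : cofinality delta theta ->
  Z `<=` below delta -> ~ (below theta #<= Z) ->
  exists2 beta, beta < delta & forall z, Z z -> z < beta.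
Proof.
move=> [_ lt] Zd Zs; apply: contrapT => unb; apply: Zs.
have Zcof : cofinal_in delta Z.
  split=> // beta bd; apply: contrapT => nex; apply: unb; exists beta => // z Zz.
  by apply: nle_lt => bz; apply: nex; exists z.
have [eta _ otZ] := order_type_sub Zd.
have te : theta <= eta by apply: lt; exists Z.
have [_] := order_type_card otZ; apply: card_le_trans.
by apply: subset_card_le => x /= xt; exact: lt_le_trans te.
Qed.

Lemma regular_not_le theta rho T (Z : set T) : is_regular theta ->
  rho < theta -> Z #<= below rho -> ~ (below theta #<= Z).
Proof.
move=> [_ ct _] rt Zr tZ; apply: (ct _ rt); exact: card_le_trans Zr.
Qed.

(** Otherwise the singleton {beta} would be cofinal. *)
Lemma regular_limit theta beta : is_regular theta -> beta < theta ->
  exists2 gamma, gamma < theta & beta < gamma.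
Proof.
move=> [inf _ cf] bt; have sub : [set beta] `<=` below theta by move=> _ ->.
have [|gamma gt gP] := small_bounded cf sub.
  by move=> /card_le_finite /(_ (finite_set1 _)).
by exists gamma => //; exact: gP.
Qed.

Lemma order_type_no_max X kappa x : is_regular kappa -> order_type X kappa ->
  X x -> exists2 y, X y & x < y.
Proof.
move=> kreg /order_typeP[f [fi fX fs]] /fs[i ik <-].
have [j jk ij] := regular_limit kreg ik.
by exists (f j); [exact: fX|exact: fi].
Qed.

Lemma initial_segment_card X kappa x : order_type X kappa -> X x ->
  exists2 eta, eta < kappa & X `&` below x #<= below eta.
Proof.
move=> /order_typeP[f [fi fX fs]] /fs[i ik <-]; exists i => //.
apply: (card_le_cover (f := f)) => y [/fs[j jk <-]] fji.
by exists j => //; apply: (increasing_lt_inv fi).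
Qed.

Lemma cofinality_ge delta theta X eta : cofinality delta theta ->
  cofinal_in delta X -> order_type X eta -> theta <= eta.
Proof. by move=> [_ lt] cX oX; apply: lt; exists X. Qed.

(** Cofinal subsets of i are pushed to gamma by f; conversely one of gamma is
    pulled back to the least indices at which f overtakes its elements. *)
Lemma cofinality_increasing (f : O -> O) i gamma kappa :
  increasing_on (below i) f -> (forall j, j < i -> f j < gamma) ->
  (forall beta, beta < gamma -> exists2 j, j < i & beta <= f j) ->
  cofinality gamma kappa -> cofinality i kappa.
Proof.
move=> fi fg fcof cfg.
have lower A eta : cofinal_in i A -> order_type A eta -> kappa <= eta.
  move=> [Ai Acof] otA.
  have [h [hi he hs]] := order_type_inv otA.
  have sub : f @` A `<=` below gamma by move=> _ [j /Ai ji <-]; exact: fg.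
  have [zeta _ otfA] := order_type_sub sub.
  have kz : kappa <= zeta.
    apply: (cofinality_ge cfg) otfA; split=> // beta /fcof[j /Acof[k Ak jk] bj].
    exists (f k); first by exists k.
    apply: le_trans bj _; apply: (increasing_le fi) => //; last exact: Ai.
    exact: le_lt_trans jk (Ai _ Ak).
  have /choice[g gP] y : exists k, (f @` A) y -> A k /\ f k = y.
    by have [[k Ak <-]|?] := pselect ((f @` A) y); [exists k|exists y].
  apply: le_trans kz _; apply: (order_type_embed otfA otA (g := g)).
    move=> x y /gP[Agx ex] /gP[Agy ey] xy.
    by apply: (increasing_lt_inv fi); [exact: Ai..|rewrite ex ey].
  by move=> y /gP[].
split; last by move=> eta [A cA otA]; exact: lower otA.
have [[B [Bg Bcof] otB] _] := cfg.
have /choice[l lP] b : exists j, B b -> is_least [set j | j < i /\ b <= f j] j.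
  have [/Bg bg|?] := pselect (B b); last by exists b.
  have [j [ji bj]] : [set j | j < i /\ b <= f j] !=set0.
    by have [j ji bj] := fcof _ bg; exists j.
  have [j' j'P] : exists j', is_least [set j | j < i /\ b <= f j] j'.
    by apply: least_exists; exists j.
  by exists j'.
have sub : l @` B `<=` below i by move=> _ [b /lP[[? _] _] <-].
have lcof : cofinal_in i (l @` B).
  split=> // j ji; have [b Bb fjb] := Bcof _ (fg _ ji).
  have [[lbi blb] _] := lP _ Bb.
  exists (l b); first by exists b.
  apply: nlt_le => /(fi _ _ lbi ji) lt.
  by have := le_lt_trans (le_trans fjb blb) lt; rewrite ltxx.
have [eta _ otl] := order_type_sub sub.
have ke := lower _ _ lcof otl.
have ek : eta <= kappa.
  have /choice[g gP] y : exists b, (l @` B) y -> B b /\ l b = y.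
    by have [[b Bb <-]|?] := pselect ((l @` B) y); [exists b|exists y].
  apply: (order_type_embed otl otB (g := g)) => [x y /gP[Bx ex] /gP[By ey] xy|y /gP[]//].
  apply: nle_lt => yx; move: xy; rewrite -ex -ey ltNge => /negP; apply.
  have [_ ll] := lP _ By; have [[? lx] _] := lP _ Bx.
  by apply: ll; split=> //; exact: le_trans yx lx.
by exists (l @` B) => //; have -> : kappa = eta by apply: le_anti; rewrite ke ek.
Qed.

(** * Regular cardinals: closure points and enumerations *)

Lemma regular_bounded lambda mu (f : O -> O) : is_regular lambda ->
  mu < lambda -> (forall j, j < mu -> f j < lambda) ->
  exists2 beta, beta < lambda & forall j, j < mu -> f j < beta.
Proof.
move=> lreg ml fl; have [_ _ cf] := lreg.
have sub : f @` below mu `<=` below lambda by move=> _ [j /fl ? <-].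
have [|beta bl bP] := small_bounded cf sub.
  by apply: (regular_not_le lreg ml); exact: card_image_le.
by exists beta => // j jm; apply: bP; exists j.
Qed.

(** The point is reached after omega steps, which stay below lambda because the
    infinite kappa < lambda makes lambda uncountable. *)
Lemma closure_point lambda kappa (h : O -> O) beta : is_regular lambda ->
  infinite_set (below kappa) -> kappa < lambda ->
  (forall j, j < lambda -> h j < lambda) -> beta < lambda ->
  exists i, [/\ i < lambda, beta < i & forall j, j < i -> h j < i].
Proof.
move=> lreg kinf kl hl bl; have [_ _ cf] := lreg.
have /choice[e eP] nu : exists nu', nu < lambda ->
    [/\ nu' < lambda, nu < nu' & forall j, j <= nu -> h j < nu'].
  have [nl|?] := pselect (nu < lambda); last by exists nu.
  have [nu1 n1l n1] := regular_limit lreg nl.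
  have [j jl|b bl' bP] := regular_bounded (f := h) lreg n1l.
    by apply: hl; exact: lt_trans n1l.
  exists (Order.max nu1 b) => _; split; first by rewrite gt_max n1l.
    by rewrite lt_max n1.
  by move=> j jn; rewrite lt_max bP ?orbT //; exact: le_lt_trans n1.
pose g n := iter n e beta.
have gl n : g n < lambda by elim: n => //= n /eP[].
have gS n : g n < g n.+1 by have [] := eP _ (gl n).
have sub : range g `<=` below lambda by move=> _ [n _ <-]; exact: gl.
have [|b bl' bP] := small_bounded cf sub.
  apply: (regular_not_le lreg kl); apply: card_le_trans (card_image_le _ _) _.
  exact/infiniteP.
have [s slub sb] : exists2 s, isLub (range g) s & s <= b.
  by apply: lub_exists => x /bP/ltW.
have gs n : g n < s.
  by apply: lt_le_trans (gS n) _; case: slub => + _; apply; exists n.+1.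
exists s; split; [exact: le_lt_trans bl'|exact: (gs 0%N)|].
move=> j /(lub_gt slub)[_ [n _ <-] jn].
have [_ _ /(_ j (ltW jn)) hj] := eP _ (gl n).
exact: lt_trans (gs n.+1).
Qed.

Lemma lexicographic_wf : well_founded (fun p q : O * O =>
  p.1 < q.1 \/ p.1 = q.1 /\ p.2 < q.2).
Proof.
move=> [a b]; elim/(well_founded_ind wfO): a b => a IHa.
elim/(well_founded_ind wfO) => b IHb.
by constructor=> -[a' b'] /= [/IHa|[->]]; last exact: IHb.
Qed.

(** The pairs (alpha, j), j indexing Q alpha by an ordinal below lambda, get their
    codes r (alpha, j) >= alpha by recursion along the lexicographic order. By
    regularity, applied within each block and then to the blocks before alpha, the
    codes given before a pair are bounded below lambda, so r stays below lambda. *)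
Lemma enumeration T (t0 : T) lambda (Q : O -> set T) : is_regular lambda ->
  (forall alpha, alpha < lambda -> exists2 mu, mu < lambda & Q alpha #<= below mu) ->
  exists (dec : O -> T) (e : O -> O), forall alpha, alpha < lambda ->
    e alpha < lambda /\ forall x, Q alpha x ->
      exists i, [/\ alpha <= i, i < e alpha & dec i = x].
Proof.
move=> lreg Qsmall.
have /choice[m mP] alpha : exists mu, alpha < lambda ->
    mu < lambda /\ exists q : O -> T, Q alpha `<=` q @` below mu.
  have [/Qsmall[mu ml]|?] := pselect (alpha < lambda); last by exists lambda.
  by move=> /(card_le_surj t0)[q qP]; exists mu => _; split=> //; exists q.
have /choice[q qP] alpha : exists q : O -> T, alpha < lambda ->
    Q alpha `<=` q @` below (m alpha).
  have [/mP[_ [q qP]]|?] := pselect (alpha < lambda); first by exists q.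
  by exists (fun=> t0).
pose valid (p : O * O) := p.1 < lambda /\ p.2 < m p.1.
pose lex (p q : O * O) := p.1 < q.1 \/ p.1 = q.1 /\ p.2 < q.2.
have wfR : well_founded (fun p q => valid p /\ lex p q).
  move=> p; elim/(well_founded_ind lexicographic_wf): p => p IH.
  by constructor=> p' [_ /IH].
have [r rP] := least_recursion wfR (fun p => [set i | p.1 <= i]) lambda.
have rl p : valid p -> [/\ r p < lambda, p.1 <= r p &
    forall p', valid p' -> lex p' p -> r p' < r p].
  elim/(well_founded_ind lexicographic_wf): p => -[a b] IH [al bm].
  have {}IH p : valid p -> lex p (a, b) -> r p < lambda.
    by move=> vp lp; have [] := IH p lp vp.
  have /choice[s sP] a' : exists s, a' < a ->
      s < lambda /\ forall j, j < m a' -> r (a', j) < s.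
    have [a'a|?] := pselect (a' < a); last by exists a.
    have a'l := lt_trans a'a al; have [ml _] := mP _ a'l.
    have [j jm|s sl sP] := regular_bounded (f := fun j => r (a', j)) lreg ml.
      by apply: IH; [split|left].
    by exists s.
  have [j /sP[]//|u ul uP] := regular_bounded (f := s) lreg al.
  have bl : b < lambda by have [ml _] := mP _ al; exact: lt_trans ml.
  have [j jb|v vl vP] := regular_bounded (f := fun j => r (a, j)) lreg bl.
    by apply: IH; [split=> //; exact: lt_trans bm|right].
  pose w := Order.max a (Order.max u v).
  have wl : w < lambda by rewrite !gt_max al ul vl.
  have wok : a <= w /\ forall p, valid p /\ lex p (a, b) -> r p < w.
    split; first by rewrite le_max lexx.
    move=> [a' b'] [[/= a'l b'm] [/= a'a|/= [-> b'b]]]; rewrite !lt_max.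
      by have [_ /(_ _ b'm) lt] := sP _ a'a; rewrite (lt_trans lt (uP _ a'a)) orbT.
    by rewrite (vP _ b'b) !orbT.
  have [[ra rR] lr] := rP (a, b) (ex_intro _ w wok).
  split=> //; first exact: le_lt_trans (lr _ wok) wl.
  by move=> p' vp' lp'; exact: rR.
have rinj p p' : valid p -> valid p' -> r p = r p' -> p = p'.
  move=> vp vp'; have [_ _ P1] := rl _ vp; have [_ _ P2] := rl _ vp'.
  case: p p' vp vp' P1 P2 => a b [a' b'] vp vp' P1 P2 rr.
  case: (ltgtP a a') => [aa'|aa'|aa'].
  - by have := P2 _ vp (or_introl aa'); rewrite rr ltxx.
  - by have := P1 _ vp' (or_introl aa'); rewrite rr ltxx.
  case: (ltgtP b b') => [bb'|bb'|bb'].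
  - by have := P2 _ vp (or_intror (conj aa' bb')); rewrite rr ltxx.
  - by have := P1 _ vp' (or_intror (conj (esym aa') bb')); rewrite rr ltxx.
  by rewrite aa' bb'.
have /choice[dec decP] i : exists x, forall p, valid p -> r p = i -> x = q p.1 p.2.
  have [[p [vp rp]]|nex] := pselect (exists p, valid p /\ r p = i).
    by exists (q p.1 p.2) => p' vp' rp'; rewrite (rinj _ _ vp vp') // rp rp'.
  by exists t0 => p vp rp; case: nex; exists p.
have /choice[e eP] alpha : exists e, alpha < lambda ->
    e < lambda /\ forall j, j < m alpha -> r (alpha, j) < e.
  have [al|?] := pselect (alpha < lambda); last by exists lambda.
  have [ml _] := mP _ al.
  have [j jm|s sl sP] := regular_bounded (f := fun j => r (alpha, j)) lreg ml.
    by have [] := rl (alpha, j) (conj al jm).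
  by exists s.
exists dec, e => alpha al; have [el ejP] := eP _ al; split=> // x.
move=> /(qP _ al)[j jm <-]; exists (r (alpha, j)).
have vp : valid (alpha, j) by [].
split; [by have [] := rl _ vp|exact: ejP|exact: (decP _ _ vp)].
Qed.

(** * Records of a coding *)

(** Whether K (x /\ beta) is a record depends only on x /\ beta, so that the
    records of an initial segment of x are an initial segment of those of x. *)
Definition records (K : set O -> O) (x : set O) : set O :=
  [set i | exists beta, [/\ x beta, K (x `&` below beta) = i &
    forall beta', x beta' -> beta' < beta ->
      K (x `&` below beta') < K (x `&` below beta)]].

Lemma setI_below X beta beta' : beta' <= beta ->
  X `&` below beta `&` below beta' = X `&` below beta'.
Proof.
move=> bb; apply/seteqP; split=> [y [[]]|y [Xy yb]] //.
by split=> //; split=> //; exact: lt_le_trans bb.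
Qed.

(** Decoding a record K (X /\ beta) gives X /\ beta, whose records are exactly the
    records of X obtained before beta, that is, those smaller than it. *)
Lemma records_coherent (K : set O -> O) (dec : O -> set O) X k :
  (forall beta, X beta -> dec (K (X `&` below beta)) = X `&` below beta) ->
  records K X k -> records K (dec k) = records K X `&` below k.
Proof.
move=> decK [beta [Xb <- rb]]; rewrite decK //; apply/seteqP; split.
  move=> i [b [[Xb' bb]]]; rewrite (setI_below _ (ltW bb)) => <- rb'.
  split; last exact: rb.
  exists b; split=> // b' Xb'' b'b.
  have b'beta := lt_trans b'b bb.
  by have := rb' b' (conj Xb'' b'beta) b'b; rewrite !setI_below // ltW.
move=> i [[b [Xb' <- rb']]]; rewrite /below /= => Kb.
have bb : b < beta.
  case: (ltgtP b beta) => // [/(rb' _ Xb)|e].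
    by move=> /(lt_trans Kb); rewrite ltxx.
  by move: Kb; rewrite e ltxx.
exists b; split; first by split.
  by rewrite setI_below // ltW.
move=> b' [Xb'' b'beta] b'b; rewrite !setI_below //; try exact: ltW.
exact: rb'.
Qed.

Lemma records_embed (K : set O -> O) X : exists g : O -> O,
  increasing_on (records K X) g /\ forall i, records K X i -> X (g i).
Proof.
have /choice[g gP] i : exists b, records K X i -> [/\ X b, K (X `&` below b) = i &
    forall beta', X beta' -> beta' < b -> K (X `&` below beta') < K (X `&` below b)].
  by have [[b bP]|?] := pselect (records K X i); [exists b|exists i].
exists g; split=> [i j ri rj ij|i /gP[]//].
have [Xi ei Pi] := gP _ ri; have [Xj ej Pj] := gP _ rj.
case: (ltgtP (g i) (g j)) => // [/(Pi _ Xj)|e].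
  by rewrite ei ej => /(lt_trans ij); rewrite ltxx.
by move: ij; rewrite -ei -ej e ltxx.
Qed.

(** The first code exceeding mu is a record. *)
Lemma records_cofinal (K : set O -> O) X gamma : cofinal_in gamma X ->
  (forall x, X x -> exists2 y, X y & x < y) ->
  (forall x, X x -> X `&` below x `<=` below (K (X `&` below x)) /\
                    K (X `&` below x) < gamma) ->
  cofinal_in gamma (records K X).
Proof.
move=> [Xg Xcof] Xlim KP; split.
  by move=> _ [b [Xb <- _]]; have [] := KP _ Xb.
move=> mu mug; have [b1 Xb1 mb1] := Xcof _ mug; have [b2 Xb2 b12] := Xlim _ Xb1.
have [b [[Xb mb] lb]] : exists b,
    is_least [set b | X b /\ mu < K (X `&` below b)] b.
  apply: least_exists; exists b2; split=> //.
  by apply: le_lt_trans mb1 _; have [+ _] := KP _ Xb2; apply.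
exists (K (X `&` below b)); last exact: ltW.
exists b; split=> // b' Xb' b'b; apply: le_lt_trans mb.
by apply: nlt_le => mb'; have := lb _ (conj Xb' mb'); rewrite leNgt b'b.
Qed.

(** * Ladder systems from coherent guesses *)

(** Only suprema of nonempty sets are added, hence 0 is not. *)
Definition closure_in delta X : set O :=
  [set beta | beta < delta /\
     (X beta \/ X `&` below beta !=set0 /\ isLub (X `&` below beta) beta)].

Lemma closure_in_closed delta X : closed_in delta (closure_in delta X).
Proof.
split=> [b []//|alpha ad [b [[bd Xb] ba]] [ub lb]].
split=> //; right; split.
  case: Xb => [Xb|[[x [Xx xb]] _]]; first by exists b.
  by exists x; split=> //; exact: lt_trans ba.
split=> [x [_ /ltW]//|u uP]; apply: lb => y [[yd Xy] ya].
case: Xy => [Xy|[_ [_ ly]]]; first exact: uP.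
by apply: ly => x [Xx xy]; apply: uP; split=> //; exact: lt_trans ya.
Qed.

Lemma closure_in_nacc delta X : nacc (closure_in delta X) `<=` X.
Proof.
move=> a [[ad [//|[X0 [ua la]]]] nacca]; exfalso; apply: nacca.
split; first by split=> //; right; split.
split=> [x [_ /ltW]//|u uP]; apply: la => x [Xx xa]; apply: uP.
by split=> //; split; [exact: lt_trans ad|left].
Qed.

Lemma closure_in_sub delta X : X `<=` below delta -> X `<=` closure_in delta X.
Proof. by move=> Xd x Xx; split; [exact: Xd|left]. Qed.

(** Sending y to the next element of X strictly above y is increasing on the
    closure: between two points of the closure, or at the second one, there is an
    element of X. *)
Lemma closure_in_order_type delta X kappa : is_regular kappa ->
  cofinal_in delta X -> order_type X kappa ->
  order_type (closure_in delta X) kappa.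
Proof.
move=> kreg [Xd Xcof] otX.
have /choice[g gP] y : exists x, closure_in delta X y ->
    is_least [set x | X x /\ y < x] x.
  have [[yd _]|?] := pselect (closure_in delta X y); last by exists y.
  have [x Xx yx] := Xcof _ yd; have [x' Xx' xx'] := order_type_no_max kreg otX Xx.
  have [z zP] : exists z, is_least [set x | X x /\ y < x] z.
    by apply: least_exists; exists x'; split=> //; exact: le_lt_trans xx'.
  by exists z.
apply: (order_type_squeeze otX (closure_in_sub Xd) (g := g)); last first.
  by move=> y /gP[[]].
move=> y y' Cy Cy' yy'; have [_ ly] := gP _ Cy; have [[_ y'g] _] := gP _ Cy'.
apply: le_lt_trans y'g; have [_ [Xy'|[_ lub]]] := Cy'; first exact: ly.
have [x [Xx xy'] yx] := lub_gt lub yy'.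
by apply: le_trans (ltW xy'); apply: ly.
Qed.

(** The trace tr k is the set that k guesses: k should be in A only if A agrees
    with this guess below k. This makes the part of A below k depend on k alone. *)
Definition coherent_points (tr : O -> set O) lambda kappa : set O :=
  [set delta | [/\ delta < lambda, kappa < delta, cofinality delta kappa &
    exists A, [/\ cofinal_in delta A, order_type A kappa &
                  forall k, A k -> tr k = A `&` below k]]].

(** The ladder at delta is the closure of the set of successors of B delta, where
    B delta is a witness A at coherent points and tr k at delta = k + 1, provided
    that tr k itself consists of points that guess it correctly. Coherent points
    are limits, so the two cases do not meet, and the ladder at k + 1 is then the
    part below k + 1 of every ladder of which k + 1 is a successor point. *)
Lemma coherent_points_approachable tr lambda kappa :
  is_regular lambda -> is_regular kappa ->
  approachable lambda (coherent_points tr lambda kappa).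
Proof.
move=> lreg kreg; pose good k B := B `<=` below k /\ forall j, B j -> tr j = B `&` below j.
have /choice[suc sucP] k : exists s, k < lambda -> is_least [set x | k < x] s.
  have [kl|?] := pselect (k < lambda); last by exists k.
  have [s sP] : exists s, is_least [set x | k < x] s.
    by apply: least_exists; exists lambda.
  by exists s.
have suc_gt k : k < lambda -> k < suc k by move=> /sucP[].
have suc_le k x : k < x -> x < lambda -> suc k <= x.
  by move=> kx xl; have [_] := sucP _ (lt_trans kx xl); apply.
have suc_lt j k : j < lambda -> k < lambda -> (suc j < suc k) = (j < k).
  move=> jl kl; apply/idP/idP => jk.
    apply: nle_lt; rewrite le_eqVlt => /orP[/eqP e|kj].
      by move: jk; rewrite e ltxx.
    have := lt_le_trans jk (suc_le _ _ kj jl) => sj.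
    by have := lt_trans sj (suc_gt _ jl); rewrite ltxx.
  by apply: le_lt_trans (suc_gt _ kl); apply: suc_le.
have suc_succ k : k < lambda -> is_successor (suc k).
  move=> kl; have [kk lk] := sucP _ kl; exists k; split=> // g gs.
  by apply: nlt_le => kg; have := lk _ kg; rewrite leNgt gs.
have limit delta : coherent_points tr lambda kappa delta ->
    forall j, j < delta -> exists2 j', j < j' & j' < delta.
  move=> [_ _ _ [A [[Ad Ac] otA _]]] j /Ac[a Aa ja].
  have [b Ab ab] := order_type_no_max kreg otA Aa.
  by exists b; [exact: le_lt_trans ab|exact: Ad].
have limit_suc k : k < lambda -> ~ coherent_points tr lambda kappa (suc k).
  move=> kl /limit/(_ k (suc_gt _ kl))[j kj js].
  have [_ /(_ _ kj)] := sucP _ kl; by rewrite leNgt js.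
have /choice[B BP] delta : exists B : set O,
    [/\ coherent_points tr lambda kappa delta ->
          [/\ cofinal_in delta B, order_type B kappa &
              forall k, B k -> tr k = B `&` below k],
        forall k, k < lambda -> delta = suc k -> good k (tr k) -> B = tr k,
        forall j, delta < lambda -> B j -> j < delta /\ suc j < delta &
        forall j, delta < lambda -> B j -> tr j = B `&` below j].
  have [cd|ncd] := pselect (coherent_points tr lambda kappa delta).
    have [_ _ _ [A AP]] := cd; exists A; split=> //.
    - by move=> k kl e; case: (limit_suc _ kl); rewrite -e.
    - have [[Ad _] _ _] := AP; move=> j dl /Ad jd; have [j' jj' j'd] := limit _ cd _ jd; split=> //.
      by apply: (le_lt_trans _ j'd); apply: suc_le => //; exact: lt_trans dl.
    - by move=> j _; have [_ _] := AP; apply.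
  have [[k [kl e gk]]|nk] :=
      pselect (exists k, [/\ k < lambda, delta = suc k & good k (tr k)]).
    have [sub coh] := gk; exists (tr k); split=> //.
    - move=> k' k'l; rewrite e => ss _; congr tr.
      by case: (ltgtP k k') => //; rewrite -suc_lt // ss ltxx.
    - move=> j dl /sub jk; rewrite e.
      have ks := suc_gt _ kl.
      by split; [exact: lt_trans ks|apply: le_lt_trans ks; exact: suc_le].
    - by move=> j _; exact: coh.
  exists set0; split=> // k kl e gk; case: nk; exists k; split=> //.
pose C delta := closure_in delta (suc @` B delta).
split=> [delta []//|]; exists (coherent_points tr lambda kappa), C.
have sucB delta : delta < lambda -> suc @` B delta `<=` below delta.
  by move=> dl _ [j Bj <-]; have [_ _ /(_ _ dl Bj)[]] := BP delta.
have Bl delta j : delta < lambda -> B delta j -> j < lambda.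
  by move=> dl Bj; have [_ _ /(_ _ dl Bj)[+ _] _] := BP delta => /lt_trans; apply.
split; [by move=> delta []| |split].
- move=> /(_ (below lambda)); case.
  + by split=> // alpha.
  + split=> // beta bl; exists beta => //.
  + by move=> x [[? []]].
- by move=> delta _; exact: closure_in_closed.
- move=> delta alpha dl nacca.
  have [k Bk sk] := closure_in_nacc nacca; subst alpha.
  have kl := Bl _ _ dl Bk.
  have [_ _ /(_ _ dl Bk)[kd skd] /(_ _ dl)coh] := BP delta.
  (* tr k is good: its elements lie in B delta, where all guesses are right *)
  have Bs : B (suc k) = tr k.
    have [_ + _ _] := BP (suc k); apply=> //.
    split=> [j|j]; rewrite coh //; first by case.
    move=> [Bj jk]; rewrite coh //.
    by rewrite setI_below // ltW.
  rewrite /C Bs coh //.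
  have sucI x : x <= suc k -> (suc @` (B delta `&` below k)) `&` below x =
                      (suc @` B delta) `&` below x.
    move=> xk; apply/seteqP; split=> [_ [[j [Bj jk] <-] jx]|_ [[j Bj <-] jx]].
      by split=> //; exists j.
    split=> //; exists j => //; split=> //.
    by rewrite /below /= -suc_lt //; [exact: lt_le_trans xk|exact: Bl Bj].
  apply/seteqP; split=> [x [xs]|x [xs]] /=.
    rewrite sucI ?(ltW xs) // => xP.
    split=> //; split; first exact: lt_trans skd.
    case: xP => [[j [Bj jk] <-]|]; [left; exists j => //|by right].
  move=> [xd xP]; split=> //.
  rewrite sucI ?(ltW xs) //; case: xP; [move=> [j Bj jx]; left|by right].
  exists j => //; split=> //.
  by rewrite /below /= -suc_lt //; [rewrite jx|exact: Bl Bj].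
- move=> delta cd; have [dl kd cfd _] := cd; have [/(_ cd)[[Bd Bcof] otB _] _ _ _] := BP delta.
  have suci : increasing_on (B delta) suc.
    by move=> x y /(Bl _ _ dl) xl /(Bl _ _ dl) yl; rewrite suc_lt.
  have Xcof : cofinal_in delta (suc @` B delta).
    split; first exact: sucB.
    move=> beta /Bcof[j Bj bj]; exists (suc j); first by exists j.
    by apply: le_trans bj (ltW _); apply: suc_gt; exact: Bl Bj.
  split.
    split=> [x [/ltW]//|u uP]; apply: nlt_le => ud.
    have [j jj jd] := limit _ cd _ ud; have [x Xx jx] := Xcof.2 _ jd.
    have /uP : C delta x by apply: closure_in_sub Xx; exact: sucB.
    by rewrite leNgt (lt_le_trans jj jx).
  exists kappa; split=> //; apply: closure_in_order_type => //.
  exact: order_type_image otB suci.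
- move=> delta dl x /closure_in_nacc[j Bj <-]; apply: suc_succ; exact: Bl Bj.
Qed.

(** * Cardinal arithmetic and transfer of the families *)

(** A copy of P in lambda is too small to be cofinal. *)
Lemma card_lt_bounded T (P : set T) lambda : is_regular lambda ->
  card_lt P (below lambda) -> exists2 mu, mu < lambda & P #<= below mu.
Proof.
move=> [_ _ cf] [Pl nlP]; have [p [pl pinj]] := card_le_injection lambda Pl.
have sub : p @` P `<=` below lambda by move=> _ [y /pl ? <-].
have [|mu ml muP] := small_bounded cf sub.
  by move=> lp; apply: nlP; exact: card_le_trans lp (card_image_le _ _).
exists mu => //; apply: (card_le_of_injection (f := p)) => // y Py.
by apply: muP; exists y.
Qed.

Lemma cardinal_of eta : exists mu,
  [/\ is_cardinal mu, mu <= eta, below mu #<= below eta & below eta #<= below mu].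
Proof.
have [mu [em lm]] : exists mu, is_least [set mu | below eta #<= below mu] mu.
  by apply: least_exists; exists eta; exact: card_lexx.
have me : mu <= eta by apply: lm; exact: card_lexx.
exists mu; split=> //.
  move=> beta bm mb; have : below eta #<= below beta by exact: card_le_trans mb.
  by move=> /lm; rewrite leNgt bm.
by apply: subset_card_le => y /= ym; exact: lt_le_trans me.
Qed.

(** The weak power speaks of cardinals mu < kappa, so eta is replaced by its
    cardinality. *)
Lemma weak_power_card kappa rho eta X : is_weak_power kappa rho ->
  eta < kappa -> X #<= below eta -> [set x | x `<=` X] #<= below rho.
Proof.
move=> [rP _] ek Xe; have [mu [cm me _ em]] := cardinal_of eta.
have Xm : X #<= below mu by exact: card_le_trans em.
have [s sP] := card_le_surj rho Xm.
apply: card_le_trans (rP mu cm (le_lt_trans me ek)).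
apply: (card_le_cover (f := fun y : set O => s @` y)) => x xX.
exists [set i | i < mu /\ x (s i)]; first by move=> i [].
apply/seteqP; split=> [_ [i [_ xi] <-]//|y xy].
by have [i im e] := sP _ (xX _ xy); exists i => //; split=> //; rewrite e.
Qed.

(** A family at the cardinal |alpha| > kappa is carried over by a bijection; at the
    other ordinals the empty family will do. *)
Lemma transferred_families lambda kappa : is_regular lambda -> kappa < lambda ->
  (forall sigma : O,
       is_cardinal sigma -> kappa < sigma -> sigma < lambda ->
       exists P : set (set O),
         [/\ P `<=` subsets_lt (below sigma) kappa,
             card_lt P (below lambda) &
             forall a, subsets_eq (below sigma) kappa a ->
               exists2 b, subsets_eq a kappa b & subsets_lt b kappa `<=` P]) ->
  exists Q : O -> set (set O), forall alpha, alpha < lambda ->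
    (exists2 mu, mu < lambda & Q alpha #<= below mu) /\
    (~ (below alpha #<= below kappa) ->
     forall a, subsets_eq (below alpha) kappa a ->
       exists2 b, subsets_eq a kappa b & subsets_lt b kappa `<=` Q alpha).
Proof.
move=> lreg kl fam.
suff /choice[Q QP] : forall alpha, exists Qa : set (set O), alpha < lambda ->
    (exists2 mu, mu < lambda & Qa #<= below mu) /\
    (~ (below alpha #<= below kappa) ->
     forall a, subsets_eq (below alpha) kappa a ->
       exists2 b, subsets_eq a kappa b & subsets_lt b kappa `<=` Qa).
  by exists Q.
move=> alpha.
have [ak|ak] := pselect (below alpha #<= below kappa).
  exists set0 => _; split; last by move=> /(_ ak).
  by exists kappa => //; exact: card_ge0.
have [al|?] := pselect (alpha < lambda); last by exists set0.
have [sigma [cs sa sale asle]] := cardinal_of alpha.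
have ks : kappa < sigma.
  apply: nle_lt => sk; apply: ak; apply: card_le_trans asle _.
  by apply: subset_card_le => y /= ys; exact: lt_le_trans sk.
have [P [_ Psmall PP]] := fam _ cs ks (le_lt_trans sa al).
have [mu ml Pmu] := card_lt_bounded lreg Psmall.
have [f [fs finj]] := card_le_injection alpha asle.
have /choice[g gP] j : exists i, forall i', i' < alpha -> f i' = j -> i = i'.
  have [[i [ia fi]]|nex] := pselect (exists i, i < alpha /\ f i = j).
    by exists i => i' i'a fi'; apply: finj => //; rewrite fi.
  by exists alpha => i' i'a fi'; case: nex; exists i'.
have gf i : i < alpha -> g (f i) = i by move=> ia; exact: gP.
exists [set g @` x | x in P] => _; split.
  exists mu => //; exact: card_le_trans (card_image_le _ _) Pmu.
move=> _ a [aa acard].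
have fcard x : x `<=` below alpha -> f @` x #= x.
  move=> xa; apply: inj_card_eq => i j; rewrite !inE => xi xj.
  by apply: finj; exact: xa.
have gfK x : x `<=` below alpha -> g @` (f @` x) = x.
  move=> xa; apply/seteqP; split=> [_ [_ [i xi <-] <-]|i xi].
    by rewrite gf //; exact: xa.
  by exists (f i); [exists i|rewrite gf //; exact: xa].
have [|b' [b'fa b'card] b'P] := PP (f @` a).
  split; first by move=> _ [i /aa ia <-]; exact: fs.
  exact: card_eq_trans (fcard _ aa) acard.
have fgK : f @` (g @` b') = b'.
  apply/seteqP; split=> [_ [_ [j /[dup] b'j /b'fa[i ai e] <-] <-]|j b'j].
    by subst j; rewrite gf //; exact: aa.
  have [i ai e] := b'fa _ b'j; exists i => //; exists j => //.
  by rewrite -e gf //; exact: aa.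
have ga : g @` b' `<=` a.
  by move=> _ [_ /b'fa[i ai <-] <-]; rewrite gf //; exact: aa.
exists (g @` b').
  split=> //; apply: card_eq_trans b'card.
  rewrite -[X in _ #= X]fgK card_eq_sym; apply: fcard.
  exact: subset_trans ga aa.
move=> x [xb [xk kx]]; have xa := subset_trans xb (subset_trans ga aa).
exists (f @` x); last exact: gfK.
apply: b'P; split; first by rewrite -fgK; exact: image_subset.
have /card_eqPle[le1 le2] := fcard _ xa.
by split; [exact: card_le_trans xk|move=> kfx; apply: kx; exact: card_le_trans le1].
Qed.

(** * Reflection at points of cofinality theta *)

(** Suprema of f over the closure points of h form a club even though f need not
    be continuous: a limit gamma of such suprema is the supremum of f over the
    supremum of the corresponding indices. *)
Lemma closure_club delta theta kappa (f h : O -> O) i0 :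
  is_regular theta -> infinite_set (below kappa) -> kappa < theta ->
  increasing_on (below theta) f ->
  (forall j, j < theta -> f j < delta) ->
  (forall beta, beta < delta -> exists2 j, j < theta & beta <= f j) ->
  i0 < theta -> (forall j, j < theta -> h j < theta) ->
  let e := [set gamma | gamma < delta /\ exists i,
    [/\ i < theta, i0 < i, forall j, j < i -> h j < i &
        isLub (f @` below i) gamma]] in
  closed_in delta e /\ cofinal_in delta e.
Proof.
move=> treg kinf kt fi fd fcof i0t ht e; split.
  split=> [gamma []//|gamma gd [g0 [eg0 g0g]] [ub lb]]; split=> //.
  pose I := [set i | [/\ i < theta, i0 < i, forall j, j < i -> h j < i &
    exists2 g, isLub (f @` below i) g & g < gamma]].
  have [j jt gj] := fcof _ gd.
  have Ij i : I i -> i <= j.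
    move=> [it _ _ [g [ug _] gg]]; apply: nlt_le => ji.
    have /ug : (f @` below i) (f j) by exists j.
    by rewrite leNgt (lt_le_trans gg gj).
  have [s slub sj] := lub_exists Ij.
  have st : s < theta := le_lt_trans sj jt.
  have Isub i : I i -> i <= s by case: slub => + _; apply.
  exists s; split=> //.
  - have [_ [i [it i0i ci gi]]] := eg0.
    by apply: (lt_le_trans i0i); apply: Isub; split=> //; exists g0.
  - move=> k /(lub_gt slub)[i Ii ki]; have [_ _ ci _] := Ii.
    exact: lt_le_trans (ci _ ki) (Isub _ Ii).
  split.
    move=> _ [k ks <-]; have [i [it i0i ci [g [ug _] gg]] ki] := lub_gt slub ks.
    by apply: le_trans (ltW gg); apply: ug; exists k.
  move=> u uP; apply: lb => g [[gdl [i [it i0i ci [ug lg]]]] gg].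
  have Ii : I i by split=> //; exists g.
  apply: lg => _ [k ki <-]; apply: uP; exists k => //.
  exact: lt_le_trans ki (Isub _ Ii).
split=> [gamma []//|beta /fcof[j jt bj]].
have [|i [it mi ci]] := closure_point (beta := Order.max i0 j) treg kinf kt ht.
  by rewrite gt_max i0t.
have [i0i ji] : i0 < i /\ j < i by move: mi; rewrite gt_max => /andP.
have [|gamma glub gfi] := lub_exists (X := f @` below i) (gamma := f i).
  by move=> _ [k ki <-]; apply: ltW; apply: fi => //; exact: lt_trans it.
exists gamma; first by split; [exact: le_lt_trans (fd _ it)|exists i].
by apply: le_trans bj _; case: glub => + _; apply; exists j.
Qed.

(** The map g only serves to bound the order type of b, and hence that of its
    records, by kappa; both are at least cf(gamma) = kappa by cofinality. *)
Lemma records_coherent_point (dec : O -> set O) (K : set O -> O) lambda kappa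
    gamma X b (g : O -> O) :
  is_regular kappa -> gamma < lambda -> kappa < gamma -> cofinality gamma kappa ->
  order_type X kappa -> increasing_on b g -> (forall y, b y -> X (g y)) ->
  cofinal_in gamma b ->
  (forall beta, b beta -> let x := b `&` below beta in
    [/\ dec (K x) = x, x `<=` below (K x) & K x < gamma]) ->
  coherent_points (fun k => records K (dec k)) lambda kappa gamma.
Proof.
move=> kreg gl kg cfg otX gi gX bcof KP; split=> //.
have [bg _] := bcof.
have [zeta zk otb] : exists2 zeta, zeta <= kappa & order_type b zeta.
  have [h [hi hk _]] := order_type_inv otX.
  apply: (@order_type_exists _ (h \o g)) => [y y' by1 by2 yy'|y by1] /=.
    by apply: hi; [exact: gX..|exact: gi].
  exact/hk/gX.
have kz : kappa <= zeta := cofinality_ge cfg bcof otb.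
have {zk kz}ez : zeta = kappa by apply: le_anti; rewrite zk kz.
rewrite {}ez in otb.
have rcof : cofinal_in gamma (records K b).
  apply: (records_cofinal bcof).
    by move=> y; exact: order_type_no_max kreg otb.
  by move=> y /KP[].
have [l [li lb]] := records_embed K b.
exists (records K b); split=> //; last first.
  by move=> k; apply: records_coherent => beta /KP[].
have [eta _ otr] := order_type_sub rcof.1.
have ke := cofinality_ge cfg rcof otr.
have ek : eta <= kappa := order_type_embed otr otb li lb.
by have <- : eta = kappa by apply: le_anti; rewrite ke ek.
Qed.

(** The reflection argument at a single delta. The hypothesis on K says that K x
    is the least code of x above the elements of x, whenever there is one; the
    last one combines the families with the closure of delta under code bounds. *)
Lemma coherent_points_club (dec : O -> set O) (K : set O -> O)
    lambda kappa delta theta rho nu :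
  is_regular kappa ->
  (forall i, dec i `<=` below i ->
     is_least [set j | dec j = dec i /\ dec i `<=` below j] (K (dec i))) ->
  delta < lambda -> cofinality delta theta -> is_regular theta ->
  kappa < theta -> is_weak_power kappa rho -> rho < theta ->
  approachable theta (cof_set theta kappa) ->
  kappa < nu -> nu < delta ->
  (forall gamma, nu <= gamma -> gamma < delta ->
    forall a, subsets_eq (below gamma) kappa a ->
      exists2 b, subsets_eq a kappa b & forall x, subsets_lt b kappa x ->
        exists i, [/\ gamma <= i, i < delta & dec i = x]) ->
  ~ stationary delta (cof_set delta kappa `\`
      coherent_points (fun k => records K (dec k)) lambda kappa).
Proof.
move=> kreg KP dl cfd treg kt powk rt [_ [Sp [C [_ nst [Ccl Ccoh Cotp _]]]]]
  knu nud fam stat.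
have [[A [Ad Acof] /order_typeP[f [fi fA fs]]] _] := cfd.
have fd j : j < theta -> f j < delta by move=> /fA/Ad.
have fcof beta : beta < delta -> exists2 j, j < theta & beta <= f j.
  by move=> /Acof[_ /fs[j jt <-] bj]; exists j.
(* a club of theta on which cofinality kappa implies membership in S^+ *)
have {nst} [D Dcl [Dcof DSp]] : exists2 D, closed_in theta D &
    cofinal_in theta D /\ forall i, cof_set theta kappa i -> D i -> Sp i.
  apply: contrapT => nD; apply: nst => D Dcl Dcof; apply: contrapT => Dout.
  apply: nD; exists D => //; split=> // i ci Di; apply: contrapT => nSp.
  by apply: Dout; exists i.
have kinf : infinite_set (below kappa) by case: kreg.
have Zbound j : (exists2 eta, eta < kappa & C j #<= below eta) ->
    exists2 H, H < theta & forall x, x `<=` f @` C j -> K x < delta -> K x < f H.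
  move=> [eta ek Ceta].
  pose Z := [set i | i < delta /\ exists2 x, x `<=` f @` C j & K x = i].
  have Zd : Z `<=` below delta by move=> i [].
  have [|beta bd bP] := small_bounded cfd Zd.
    apply: (regular_not_le treg rt).
    have fCeta : f @` C j #<= below eta.
      exact: card_le_trans (card_image_le _ _) Ceta.
    apply: card_le_trans (weak_power_card powk ek fCeta).
    by apply: (card_le_cover (f := K)) => i [_ [x xf <-]]; exists x.
  have [H Ht bH] := fcof _ bd; exists H => // x xf xd.
  by apply: lt_le_trans bH; apply: bP; split=> //; exists x.
(* one function h for three purposes: closure under it makes i a limit, a
   point of D, and an index bounding the codes attached to the ladders C j *)
have /choice[h hP] j : exists H, j < theta -> [/\ H < theta, j < H,
    exists i, [/\ D i, j <= i & i < H] &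
    (exists2 eta, eta < kappa & C j #<= below eta) ->
    forall x, x `<=` f @` C j -> K x < delta -> K x < f H].
  have [jt|?] := pselect (j < theta); last by exists j.
  have [i Di ji] := Dcof.2 _ jt.
  have [i' i't ii'] := regular_limit treg (Dcof.1 _ Di).
  have [smC|nsm] := pselect (exists2 eta, eta < kappa & C j #<= below eta); last first.
    by exists i' => _; split=> //; [exact: le_lt_trans ii'|exists i].
  have [H Ht HP] := Zbound _ smC.
  have Mt : Order.max i' H < theta by rewrite gt_max i't.
  exists (Order.max i' H) => _; split=> //.
  - by rewrite lt_max (le_lt_trans ji ii').
  - by exists i; split=> //; rewrite lt_max ii'.
  move=> _ x xf xd; apply: lt_le_trans (HP _ xf xd) _.
  by apply: (increasing_le fi) => //; rewrite le_max lexx orbT.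
have [i0 i0t nui0] := fcof _ nud.
have ht j : j < theta -> h j < theta by move=> /hP[].
have [ecl ecof] := closure_club treg kinf kt fi fd fcof i0t ht.
have [gamma [[[gd cfg] ngamma] [_ [i [it i0i ci glub]]]]] := stat _ ecl ecof.
apply: ngamma.
have fg j : j < i -> f j < gamma.
  move=> ji; have jt := lt_trans ji it; have [hjt jh _ _] := hP _ jt.
  apply: lt_le_trans (fi _ _ jt hjt jh) _.
  by case: glub => + _; apply; exists (h j) => //; exact: ci.
have fgcof beta : beta < gamma -> exists2 j, j < i & beta <= f j.
  by move=> /(lub_gt glub)[_ [j ji <-] /ltW bj]; exists j.
have fii : increasing_on (below i) f.
  by move=> j j' ji j'i; apply: fi; exact: lt_trans it.
have cfi : cofinality i kappa := cofinality_increasing fii fg fgcof cfg.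
(* between j and h j there is a point of D, so i is a limit of D *)
have Di : D i.
  apply: (Dcl.2) => //.
    have [_ _ [k [Dk jk kh]] _] := hP _ i0t.
    by exists k; split=> //; exact: lt_trans (ci _ i0i).
  split=> [k [_ /ltW]//|u uP]; apply: nlt_le => ui.
  have [_ _ [k [Dk uk kh]] _] := hP _ (lt_trans ui it).
  have [hu uh _ _] := hP _ (lt_trans ui it).
  have hui := ci _ ui.
  have [_ _ [k' [Dk' hk' k'h]] _] := hP _ hu.
  have /uP : (D `&` below i) k' by split=> //; exact: lt_trans (ci _ hui).
  by rewrite leNgt (lt_le_trans uh hk').
have [Club [kappa' [otC cfi' _]]] := Cotp _ (DSp _ (conj it cfi) Di).
have ekappa : kappa' = kappa by exact: least_unique cfi' cfi.
subst kappa'.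
have [Ci _] := Ccl _ it.
have Cinj : {in C i &, injective f}.
  by move=> j j'; rewrite !inE => /Ci ji /Ci j'i; exact: (increasing_inj fii).
have nug : nu <= gamma := le_trans nui0 (ltW (fg _ i0i)).
have [|b [bfC bk] bfam] := fam _ nug gd (f @` C i).
  split; first by move=> _ [j /Ci ji <-]; exact: fg.
  apply: card_eq_trans (inj_card_eq Cinj) _.
  by have [? ?] := order_type_card otC; apply/card_eqPle.
have /card_eqPle[bk1 bk2] := bk.
have bseg j : C i j -> b `&` below (f j) `<=` f @` (C i `&` below j).
  move=> Cj y [/bfC[j' Cj' <-]] fj'; exists j' => //; split=> //.
  by apply: (increasing_lt_inv fii) fj'; exact: Ci.
have segsmall j : C i j -> exists2 eta, eta < kappa & C i `&` below j #<= below eta.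
  exact: initial_segment_card otC.
(* b has size kappa, but only a smaller part of f[C_i] lies below any beta < gamma *)
have bcof : cofinal_in gamma b.
  split; first by move=> y /bfC[j /Ci ji <-]; exact: fg.
  move=> beta bg; apply: contrapT => nex.
  have [j ji bj] := fgcof _ bg; have [c Cc jc] := lub_gt Club ji.
  have [eta ek ceta] := segsmall _ Cc.
  apply: (regular_not_le kreg ek ceta); apply: card_le_trans bk2 _.
  apply: (card_le_cover (f := f)); apply: subset_trans (bseg _ Cc) => y by1.
  split=> //; apply: nle_lt => cy; apply: nex; exists y => //.
  apply: le_trans bj (le_trans _ cy); apply: (increasing_le fii) (ltW jc) => //.
  exact: Ci.
have /choice[g gP] y : exists j, b y -> C i j /\ f j = y.
  by have [/bfC[j Cj <-]|?] := pselect (b y); [exists j|exists y].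
apply: (records_coherent_point (X := C i) (b := b) (g := g)) => //.
- exact: lt_trans dl.
- exact: lt_le_trans nug.
- move=> y y' /gP[Cy ey] /gP[Cy' ey'] yy'.
  by apply: (increasing_lt_inv fii); [exact: Ci..|rewrite ey ey'].
- by move=> y /gP[].
move=> beta bb; have [j Cj ej] := bfC _ bb; rewrite -{}ej in bb *.
move=> x; have [eta ek jeta] := segsmall _ Cj.
have xsub : x `<=` f @` (C i `&` below j) := bseg _ Cj.
have xsmall : x #<= below eta.
  apply: card_le_trans (subset_card_le xsub) _.
  exact: card_le_trans (card_image_le _ _) jeta.
have [|k [gk kd ek']] := bfam x.
  split; first by move=> y [].
  split; last exact: regular_not_le kreg ek xsmall.
  apply: card_le_trans xsmall _; apply: subset_card_le => y /= ye.
  exact: lt_trans ek.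
have xg : x `<=` below gamma by move=> y [/(bcof.1) yg _].
have xk : dec k `<=` below k by rewrite ek' => y /xg yg; exact: lt_le_trans gk.
have [[K1 K2] Kmin] := KP _ xk; rewrite ek' in K1 K2 Kmin.
have Kd : K x < delta by apply: le_lt_trans kd; apply: Kmin; rewrite -ek'.
split=> //.
(* the next element c of C_i after j is in nacc(C_i), so that C_c is C_i below c,
   which contains the points needed to cover x *)
have [c0 Cc0 jc0] := order_type_no_max kreg otC Cj.
have [c [[Cc jc] lc]] : exists c, is_least [set c | C i c /\ j < c] c.
  by apply: least_exists; exists c0.
have naccc : nacc (C i) c.
  split=> // -[_ [uc lc']]; have /lc' : ubound (C i `&` below c) j.
    move=> y [Cy yc]; apply: nlt_le => jy.
    by have := lc y (conj Cy jy); rewrite leNgt yc.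
  by rewrite leNgt jc.
have Ceq := Ccoh _ _ it naccc.
have ct := lt_trans (Ci _ Cc) it.
have Ceq' : C i `&` below j `<=` C c.
  by rewrite Ceq => y [Cy yj]; split=> //; exact: lt_trans jc.
have [_ _ _ hcP] := hP _ ct; apply: lt_trans (fg _ (ci _ (Ci _ Cc))).
apply: hcP Kd; first by rewrite Ceq setIC; exact: segsmall.
exact: subset_trans xsub (image_subset f Ceq').
Qed.

End Ordinals.

Theorem theorem4p0 (d : Order.disp_t) (O : orderType d) (wfO : well_ordered O)
    (lambda kappa : O)
    (lambda_regular : is_regular lambda) (kappa_regular : is_regular kappa)
    (kappa_lt_lambda : (kappa < lambda)%O)
    (small_families : forall sigma : O,
       is_cardinal sigma -> (kappa < sigma)%O -> (sigma < lambda)%O ->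
       exists P : set (set O),
         [/\ P `<=` subsets_lt (below sigma) kappa,
             card_lt P (below lambda) &
             forall a, subsets_eq (below sigma) kappa a ->
               exists2 b, subsets_eq a kappa b & subsets_lt b kappa `<=` P]) :
  exists2 S : set O, approachable lambda S &
    ~ stationary lambda
        [set delta : O | (delta < lambda)%O /\
           exists theta : O,
             [/\ cofinality delta theta,
                 is_regular theta,
                 (kappa < theta)%O /\ (theta < lambda)%O,
                 exists2 rho : O, is_weak_power kappa rho & (rho < theta)%O &
                 approachable theta (cof_set theta kappa) /\
                 stationary delta (cof_set delta kappa `\` S)]].
Proof.
have [Q QP] := transferred_families wfO lambda_regular kappa_lt_lambda small_families.
have [alpha /QP[]//|dec [e eP]] := enumeration wfO set0 (Q := Q) lambda_regular.
have /choice[K KP] x : exists k, forall i, dec i = x -> x `<=` below i ->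
    is_least [set j | dec j = x /\ x `<=` below j] k.
  have [[i [di xi]]|nex] := pselect (exists i, dec i = x /\ x `<=` below i).
    have [k kP] : exists k, is_least [set j | dec j = x /\ x `<=` below j] k.
      by apply: (least_exists wfO); exists i.
    by exists k.
  by exists lambda => i di xi; case: nex; exists i.
exists (coherent_points (fun k => records K (dec k)) lambda kappa).
  exact: coherent_points_approachable.
move=> stat.
have kinf : infinite_set (below kappa) by case: kappa_regular.
(* without a regular theta in between, the set in question is empty *)
have [[theta0 [treg0 kt0 tl0]]|notheta] :=
    pselect (exists theta : O, [/\ is_regular theta, (kappa < theta)%O & (theta < lambda)%O]);
    last first.
  have [||delta [[_ [theta [_ treg [kt tl] _ _]]] _]] := stat (below lambda).
  - by split.
  - by split=> // beta bl; exists beta.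
  - by apply: notheta; exists theta.
have nle0 : ~ card_le (below theta0) (below kappa).
  by have [_ ct _] := treg0; exact: ct.
(* theta0 has cardinality above kappa, so above it the families are available *)
pose E := [set delta : O | [/\ (delta < lambda)%O, (theta0 < delta)%O &
  forall alpha, (alpha < delta)%O -> (e alpha < delta)%O]].
have Ecl : closed_in lambda E.
  split=> [delta []//|alpha al [d0 [[_ td _] d0a]] lub]; split=> //.
    exact: lt_trans d0a.
  move=> xi /(lub_gt lub)[delta [[_ _ ed] da] xid].
  exact: lt_trans (ed _ xid) da.
have Ecof : cofinal_in lambda E.
  split=> [delta []//|beta bl].
  have [||delta [dl bd ed]] := closure_point wfO (h := e)
      (beta := Order.max theta0 beta) lambda_regular kinf kappa_lt_lambda.
  - by move=> j /eP[].
  - by rewrite gt_max tl0.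
  move: bd; rewrite gt_max => /andP[td bd].
  by exists delta; [split|exact: ltW].
have [delta [[dl [theta [cfd treg [kt _] [rho powk rt] [appr statd]]]] [_ td ed]]] :=
  stat _ Ecl Ecof.
apply: (coherent_points_club wfO kappa_regular _ dl cfd treg kt powk rt appr
          kt0 td _ statd); first by move=> i iP; exact: KP iP.
move=> gamma tg gd a acard; have gl := lt_trans gd dl.
have [_ Qg] := QP _ gl; have [|b bcard bQ] := Qg _ _ acard.
  move=> gk; apply: nle0; apply: card_le_trans gk.
  by apply: subset_card_le => y /= yt; exact: lt_le_trans tg.
exists b => // x /bQ Qx; have [_ /(_ _ Qx)[i [gi ie di]]] := eP _ gl.
by exists i; split=> //; exact: lt_trans (ed _ gd).
Qed.
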